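(* Let $(X,f)$ be an invertible zero-dimensional system. Suppose that $(X,f)$ is densely aperiodic. Then there exists a minimal basic set $B$ that is continuously decisive (i.e., $\operatorname{int} B = \emptyset$) and such that $|M \cap B| = 1$ for each minimal set $M \in \mathcal{M}_f$.
   Context: An (invertible) zero-dimensional system $(X,f)$ is a non-empty compact metrizable zero-dimensional space $X$ with a homeomorphism $f : X \to X$. For $x \in X$, $O(x) = \{f^n(x) \mid n \in \mathbb{Z}\}$, and for $A \subseteq X$, $O(A) = \bigcup_{n \in \mathbb{Z}} f^n(A)$. A point $x$ is aperiodic if $O(x)$ is infinite; $(X,f)$ is densely aperiodic if the set of aperiodic points is dense in $X$. A minimal set is a non-empty closed set $M \subseteq X$ with $f(M) = M$ such that every orbit in $M$ is dense in $M$; $\mathcal{M}_f$ is the set of all minimal sets. A closed set $A \subseteq X$ is a quasi-section if every open set $U \supseteq A$ satisfies $O(U) = X$. A closed set $A \subseteq X$ is a basic set if $A$ is a quasi-section and $|O(x) \cap A| \le 1$ for every $x \in X$. A minimal basic set is a basic set that is minimal with respect to inclusion among basic sets. A basic set $B$ is continuously decisive if its interior $\operatorname{int} B$ is empty. *)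

(* Defs.v *)
From HB Require Import structures.
From mathcomp Require Import all_boot all_order all_algebra.
From mathcomp Require Import all_classical all_reals all_analysis.

Set Implicit Arguments.
Unset Strict Implicit.
Unset Printing Implicit Defensive.

Local Open Scope classical_set_scope.

Record homeomorphism (X Y : topologicalType) := Homeomorphism {
  homeo_fun :> X -> Y ;
  homeo_inv : Y -> X ;
  homeo_funK : cancel homeo_fun homeo_inv ;
  homeo_invK : cancel homeo_inv homeo_fun ;
  homeo_fun_continuous : continuous homeo_fun ;
  homeo_inv_continuous : continuous homeo_inv
}.

Definition metrizable (R : realType) (X : topologicalType) : Prop :=
  exists M : metricType R, inhabited (homeomorphism X M).

(* The library's [zero_dimensional] says that clopen sets separate points; on
   compact Hausdorff spaces this is the existence of a base of clopen sets,
   see [zero_dimensional_basisP] below. *)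
Definition zero_dim_space (R : realType) (X : topologicalType) : Prop :=
  [/\ [set: X] !=set0, compact [set: X], metrizable R X & zero_dimensional X].

Lemma zero_dimensional_basisP (X : topologicalType) :
  hausdorff_space X -> compact [set: X] ->
  zero_dimensional X <-> basis (@clopen X).
Proof.
move=> hX cX; split=> [zX|[_ bX] x y xy].
  split=> [U []//|x].
  by under eq_set do rewrite andC; exact: zero_dimensional_cvg.
have /(bX x)[U [cU Ux] Uy] : nbhs x (~` [set y]).
  apply: open_nbhs_nbhs; split; last exact/eqP.
  exact/closed_openC/accessible_closed_set1/hausdorff_accessible.
by exists U; split=> // /Uy; exact.
Qed.

Section dynamics.
Context {X : topologicalType}.
Implicit Types (f : homeomorphism X X) (A B M : set X) (x : X).

Definition iterz f (n : int) : X -> X :=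
  match n with
  | Posz m => iter m f
  | Negz m => iter m.+1 (homeo_inv f)
  end.

Definition zorbit f x : set X := range (fun n : int => iterz f n x).

Definition zorbit_set f A : set X :=
  \bigcup_(n in [set: int]) (iterz f n @` A).

Definition aperiodic f x : Prop := infinite_set (zorbit f x).

Definition densely_aperiodic f : Prop := dense [set x | aperiodic f x].

Definition minimal_set f M : Prop :=
  [/\ M !=set0, closed M, f @` M = M &
      forall x, M x -> M `<=` closure (zorbit f x)].

Definition quasi_section f A : Prop :=
  closed A /\
  forall U : set X, open U -> A `<=` U -> zorbit_set f U = [set: X].

Definition basic_set f A : Prop :=
  quasi_section f A /\ forall x, (zorbit f x `&` A #<= `I_1)%card.

Definition minimal_basic_set f B : Prop :=
  basic_set f B /\ forall A, basic_set f A -> A `<=` B -> A = B.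

Definition continuously_decisive f B : Prop :=
  basic_set f B /\ interior B = set0.

End dynamics.

(* Main.v *)
Require Import Defs.
From HB Require Import structures.
From mathcomp Require Import all_boot all_order all_algebra.
From mathcomp Require Import all_classical all_reals all_analysis.
From mathcomp Require Import zify.

Local Open Scope classical_set_scope.

(* Countably many clopen sets separate the points of X, hence order X
   lexicographically.  The points that are maximal in their own orbit form a
   closed set meeting each orbit at most once, and meeting each minimal set M
   exactly in max M.  Let B be the closure of the set of all these max M: it
   meets every minimal set, hence is a quasi-section, and any smaller basic set
   must contain every max M.  If V = int B were non-empty, it would contain a
   point m of a minimal set, and f^n(m) would lie in V for some n > 0.
   The non-empty open set of the y in V with f^n(y) in V then contains an
   aperiodic y, and B meets the orbit of y in the distinct points y, f^n(y). *)

(** * Integer iterates, invariant sets and existence of minimal sets *)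

Section iterz.
Context {X : topologicalType}.
Variable f : homeomorphism X X.
Implicit Types (m n : int) (x y : X) (A M : set X).

Lemma iterz1D n x : iterz f (1 + n)%R x = f (iterz f n x).
Proof.
by case: n => [n|[|n]] //=; rewrite homeo_invK ?subn1.
Qed.

Lemma iterzB1 n x : iterz f (n - 1)%R x = homeo_inv f (iterz f n x).
Proof.
have := iterz1D (n - 1)%R x; rewrite GRing.addrC GRing.subrK => ->.
by rewrite homeo_funK.
Qed.

Lemma iterzD m n x : iterz f (m + n)%R x = iterz f m (iterz f n x).
Proof.
elim: m => [|m IH|m IH]; first by rewrite GRing.add0r.
- by rewrite intS -GRing.addrA !iterz1D IH.
- by rewrite intS GRing.opprD GRing.addrC GRing.addrCA GRing.addrC iterzB1
    (GRing.addrC n) IH (GRing.addrC (-1)%R) iterzB1.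
Qed.

Lemma iterzNK n x : iterz f (- n)%R (iterz f n x) = x.
Proof. by rewrite -iterzD GRing.addNr. Qed.

Lemma iterz_continuous n : continuous (iterz f n).
Proof.
have iter_cont (g : X -> X) k : continuous g -> continuous (iter k g).
  move=> cg; elim: k => [|k IH] x /=; first exact: cvg_id.
  by apply: continuous_comp; [exact: IH|exact: cg].
case: n => n; apply: iter_cont.
- exact: homeo_fun_continuous.
- exact: homeo_inv_continuous.
Qed.

Definition finvariant A := forall x, A (f x) <-> A x.

Lemma finvariant_iterz A n x : finvariant A -> A (iterz f n x) <-> A x.
Proof.
move=> fA; elim: n => [//|n IH|n IH]; first by rewrite intS iterz1D fA.
by rewrite intS GRing.opprD GRing.addrC iterzB1 -fA homeo_invK.
Qed.

Lemma finvariantC A : finvariant A -> finvariant (~` A).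
Proof. by move=> fA x; rewrite /setC /= fA. Qed.

Lemma finvariant_image A : f @` A = A -> finvariant A.
Proof.
move=> fA x; split=> [|Ax]; last by rewrite -fA; exists x.
by rewrite -[in X in X -> _]fA => -[y Ay] /(can_inj (@homeo_funK _ _ f)) <-.
Qed.

Lemma image_finvariant A : finvariant A -> f @` A = A.
Proof.
move=> fA; apply/seteqP; split=> [_ [x Ax <-]|x Ax]; first exact/fA.
by exists (homeo_inv f x); [rewrite -fA homeo_invK|rewrite homeo_invK].
Qed.

Lemma finvariant_zorbit x : finvariant (zorbit f x).
Proof.
move=> y; split=> -[n _ E].
- by exists (n - 1)%R => //; rewrite iterzB1 E homeo_funK.
- by exists (1 + n)%R => //; rewrite iterz1D E.
Qed.

Lemma finvariant_closure A : finvariant A -> finvariant (closure A).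
Proof.
move=> fA x; split=> clA N.
- move=> Nx; have [|y [Ay Ny]] := clA (homeo_inv f @^-1` N).
    by apply: homeo_inv_continuous; rewrite homeo_funK.
  by exists (homeo_inv f y); split=> //; rewrite -fA homeo_invK.
- move=> Nx; have [|y [Ay Ny]] := clA (f @^-1` N).
    exact: homeo_fun_continuous.
  by exists (f y); split=> //; rewrite fA.
Qed.

Lemma finvariant_zorbit_set A : finvariant (zorbit_set f A).
Proof.
move=> y; split=> -[n _ [x Ax E]].
- by exists (n - 1)%R => //; exists x => //; rewrite iterzB1 E homeo_funK.
- by exists (1 + n)%R => //; exists x => //; rewrite iterz1D E.
Qed.

Lemma open_zorbit_set A : open A -> open (zorbit_set f A).
Proof.
move=> oA; apply: bigcup_open => n _.
rewrite (_ : _ @` _ = iterz f (- n)%R @^-1` A).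
  by apply: open_comp => // x _; exact: iterz_continuous.
apply/seteqP; split=> [_ [x Ax <-]|x /= Ax]; first by rewrite /= iterzNK.
by exists (iterz f (- n)%R x) => //; rewrite -iterzD GRing.subrr.
Qed.

Lemma zorbit_refl x : zorbit f x x. Proof. by exists 0%R. Qed.

Lemma minimal_set_zorbit M x y : minimal_set f M -> M x -> zorbit f x y -> M y.
Proof.
move=> [_ _ fM _] Mx [n _ <-].
by rewrite finvariant_iterz//; exact: finvariant_image.
Qed.

(** Dividing the exponent by [n.+1] with remainder reduces every integer iterate of [x] to one of
    the first [n.+1] forward iterates. *)
Lemma periodic_zorbit_finite (n : nat) x :
  iter n.+1 f x = x -> finite_set (zorbit f x).
Proof.
move=> fx; apply: (@sub_finite_set _ _ ((fun k => iter k f x) @` `I_n.+1)).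
  move=> _ [k _ <-].
  have fq q : iterz f (q * n.+1%:Z)%R x = x.
    elim: q => [|q IH|q IH]; first by rewrite GRing.mul0r.
      by rewrite intS GRing.mulrDl GRing.mul1r iterzD IH.
    rewrite -[in RHS]IH intS GRing.opprD GRing.mulrDl GRing.mulN1r.
    by rewrite iterzD IH -{1}fx -/(iterz f n.+1%:Z x) iterzNK.
  rewrite (divz_eq k n.+1%:Z) GRing.addrC iterzD fq.
  have : (0 <= (k %% n.+1%:Z)%Z)%R by exact: modz_ge0.
  have : ((k %% n.+1%:Z)%Z < n.+1%:Z)%R by exact: ltz_pmod.
  by case: (k %% n.+1%:Z)%Z => // r rn _; exists r.
exact/finite_image/finite_II.
Qed.

(** Zorn's lemma is applied to the open invariant sets that do not cover [A]; removing a maximal one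
    from [A] leaves a minimal set. *)
Lemma exists_minimal_set A : compact [set: X] ->
  closed A -> finvariant A -> A !=set0 -> exists2 M, minimal_set f M & M `<=` A.
Proof.
move=> cX clA fA A0.
pose P V := [/\ open V, finvariant V & A `\` V !=set0].
have [F FP Ftot|V [[oV fV AV0] Vmax]] := @Zorn_bigcup X P.
  split.
  - by apply: bigcup_open => V /FP[].
  - move=> x; split=> -[V FV Vx]; have [_ fV _] := FP _ FV;
      by exists V => //; apply/fV.
  (* If the union of the chain covered [A], the sets [A \ V] would form a filter base on the compact
     set [A]. A cluster point lies in some [V] of the chain, a neighbourhood disjoint from
     [A \ V]. *)
  - apply: contrapT => /set0P/negP/negPn/eqP.
    rewrite setD_eq0 => AF.
    have [x Ax] := A0; have [V0 FV0 _] := AF _ Ax.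
    pose G := filter_from F (fun V => A `\` V).
    have GF : ProperFilter G.
      apply: filter_from_proper; last by move=> V /FP[].
      apply: filter_from_filter => [|V W FV FW]; first by exists V0.
      have [VW|WV] := Ftot _ _ FV FW.
      + by exists W => // y [Ay Wy]; do 2?split=> //; move/VW.
      + by exists V => // y [Ay Vy]; do 2?split=> //; move/WV.
    have GA : G A by exists V0 => // y [].
    have [y [Ay Gy]] := subclosed_compact clA cX (@subsetT _ A) GF GA.
    have [V FV Vy] := AF _ Ay; have [oV _ _] := FP _ FV.
    have [|z [[_ nVz] Vz]] := Gy (A `\` V) V _ (open_nbhs_nbhs (conj oV Vy)).
      by exists V.
    exact: nVz.
exists (A `\` V); last by move=> x [].
split=> //.
- by rewrite setDE; apply: closedI => //; exact: open_closedC.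
- by apply: image_finvariant => x; rewrite /setD /= fA fV.
- move=> x [Ax Vx] y [Ay Vy]; apply: contrapT => yO.
  (* If the orbit of [x] stayed away from [y], adding the complement of its closure would enlarge
     [V] by [y] and still leave out [x]. *)
  apply: (Vmax (V `|` ~` closure (zorbit f x))).
    split; first by move=> z; left.
    by move=> /(_ y) H; apply/Vy/H; right.
  split.
  - by apply: openU => //; exact/closed_openC/closed_closure.
  - have fO := finvariantC _ (finvariant_closure _ (finvariant_zorbit x)).
    move=> z; split=> -[Vz|/(fO z) Oz]; [left|right|left|right] => //; exact/fV.
  - exists x; split=> // -[//|]; apply; exact/subset_closure/zorbit_refl.
Qed.
End iterz.

(** * Countably many separating clopen sets *)

Lemma metric_clopen_countable (R : realType) (M : metricType R) :
  compact [set: M] -> countable (@clopen M).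
Proof.
move=> cM; have [M0|/set0P[m _]] := eqVneq [set: M] set0.
  apply: (@sub_countable _ _ _ [set set0]) => //; apply: subset_card_le => A _.
  by apply/seteqP; split=> // x; rewrite -M0.
pose P : pseudoPMetricType R := HB.pack M (isPointed.Build M m).
exact: (@clopen_countable P cM (@compact_second_countable R P cM)).
Qed.


Lemma homeomorphism_clopen (X Y : topologicalType) (h : homeomorphism X Y)
  (U : set X) : clopen U -> clopen (homeo_inv h @^-1` U).
Proof.
move=> [oU cU]; split.
- by apply: open_comp => // y _; exact: homeo_inv_continuous.
- apply: closed_comp => // y _; exact: homeo_inv_continuous.
Qed.

Lemma homeomorphism_compact (X Y : topologicalType) (h : homeomorphism X Y) :
  compact [set: X] -> compact [set: Y].
Proof.
move=> cX; rewrite (_ : [set: Y] = h @` [set: X]).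
  apply: continuous_compact => //; apply: continuous_subspaceT.
  exact: homeo_fun_continuous.
by apply/seteqP; split=> // y _; exists (homeo_inv h y); rewrite ?homeo_invK.
Qed.

Lemma countable_clopen_separation (R : realType) (X : topologicalType) :
  zero_dim_space R X ->
  exists2 U : nat -> set X, (forall k, clopen (U k)) &
    forall x y, x <> y -> exists k, U k x /\ ~ U k y.
Proof.
move=> [_ cX [M [h]] zX].
have [g ginj] : exists g : set M -> nat, {in (@clopen M : set _) &, injective g}.
  exact/countable_injP/metric_clopen_countable/(homeomorphism_compact X M h).
(* [U k] is the pullback along [h] of the clopen set numbered [k] by [g], and is empty when [k]
   numbers no clopen set. *)
pose U k x := exists C : set M, [/\ clopen C, g C = k & C (h x)].
have UE C : clopen C -> U (g C) = h @^-1` C.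
  move=> oC; apply/seteqP; split=> [x [D [oD gDC Dx]]|x Cx]; last by exists C.
  by rewrite /preimage /= -(ginj D C _ _ gDC) ?inE.
exists U.
- move=> k; have [[C [oC <-]]|nC] := pselect (exists C, clopen C /\ g C = k).
    rewrite UE//; split.
      by apply: open_comp; [move=> *; exact: homeo_fun_continuous|case: oC].
    by apply: closed_comp; [move=> *; exact: homeo_fun_continuous|case: oC].
  rewrite (_ : U k = set0); first exact: clopen0.
  by apply/seteqP; split=> // x [C [? ? _]]; apply: nC; exists C.
- move=> x y /eqP/zX[V [cV Vx nVy]].
  exists (g (homeo_inv h @^-1` V)).
  by rewrite UE ?/preimage /= ?homeo_funK//; exact: homeomorphism_clopen.
Qed.

(** * The lexicographic order and its maxima *)

Section lexicographic.
Context {X : topologicalType}.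
Variable U : nat -> set X.
Hypothesis clopenU : forall k, clopen (U k).
Hypothesis sepU : forall x y, x <> y -> exists k, U k x /\ ~ U k y.

(** This compares the sequences of indicators of the sets [U k]; the witness [k] is the first index
    where they differ. *)
Definition lex_lt (x y : X) := exists k,
  [/\ forall j, (j < k)%N -> (U j x <-> U j y), ~ U k x & U k y].

Lemma lex_lt_total x y : x <> y -> lex_lt x y \/ lex_lt y x.
Proof.
move=> /sepU[k0 [Ux nUy]].
have ex : exists k, `[< ~ (U k x <-> U k y) >].
  by exists k0; apply/asboolP => -[] /(_ Ux).
case: (ex_minnP ex) => k /asboolP kP kmin.
have agree j : (j < k)%N -> (U j x <-> U j y).
  move=> jk; apply: contrapT => /asboolP /kmin; by rewrite leqNgt jk.
have [Ukx|nUkx] := pselect (U k x); have [Uky|nUky] := pselect (U k y).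
- by exfalso; apply: kP.
- by right; exists k; split=> // j /agree ->.
- by left; exists k.
- by exfalso; apply: kP.
Qed.

Lemma agree_near k x : \forall y \near x, U k y <-> U k x.
Proof.
have [oU cU] := clopenU k.
have [Ux|nUx] := pselect (U k x).
- have : nbhs x (U k) by exact: open_nbhs_nbhs.
  by apply: filterS.
- have : nbhs x (~` U k) by apply: open_nbhs_nbhs; split=> //; exact/closed_openC.
  by apply: filterS.
Qed.

Lemma agree_upto_near k x :
  \forall y \near x, forall j, (j < k)%N -> (U j y <-> U j x).
Proof.
elim: k => [|k IH]; first exact: nearW.
near=> y.
have yk : U k y <-> U k x by near: y; exact: agree_near.
have yltk : forall j, (j < k)%N -> (U j y <-> U j x) by near: y.
by move=> j; rewrite ltnS leq_eqVlt => /predU1P[->//|/yltk].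
Unshelve. all: by end_near. Qed.

(** A strict comparison is decided by finitely many of the clopen sets, and membership in each of
    these is locally constant. *)
Lemma open_lex_lt (g h : X -> X) : continuous g -> continuous h ->
  open [set x | lex_lt (g x) (h x)].
Proof.
move=> cg ch; rewrite openE => x [k [agree nUk Uk]] /=; rewrite /interior /=.
have gx : \forall y \near x, forall j, (j < k.+1)%N -> (U j (g y) <-> U j (g x)).
  exact: cg (agree_upto_near k.+1 (g x)).
have hx : \forall y \near x, forall j, (j < k.+1)%N -> (U j (h y) <-> U j (h x)).
  exact: ch (agree_upto_near k.+1 (h x)).
near=> y.
have gy : forall j, (j < k.+1)%N -> (U j (g y) <-> U j (g x)) by near: y.
have hy : forall j, (j < k.+1)%N -> (U j (h y) <-> U j (h x)) by near: y.
exists k; split.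
- by move=> j jk; rewrite gy ?hy ?agree // ltnW.
- by rewrite gy.
- by rewrite hy.
Unshelve. all: by end_near. Qed.

Fixpoint lex_greedy (M : set X) k := if k is k'.+1 then
    if pselect (lex_greedy M k' `&` U k' !=set0) then lex_greedy M k' `&` U k'
    else lex_greedy M k'
  else M.

(* The greedy sets decrease to the points whose membership in each U k is decided
   as favourably as possible, that is, to the maximum of M. *)
Lemma exists_lex_max M : compact [set: X] -> closed M -> M !=set0 ->
  exists2 m, M m & forall y, M y -> ~ lex_lt m y.
Proof.
move=> cX cM M0.
have greedy0 k : lex_greedy M k !=set0 by elim: k => //= k IH; case: pselect.
have greedy_closed k : closed (lex_greedy M k).
  elim: k => //= k IH; case: pselect => //= _.
  by apply: closedI => //; case: (clopenU k).
have greedyS k : lex_greedy M k.+1 `<=` lex_greedy M k.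
  by move=> x /=; case: pselect => //= _ [].
have greedy_le j k : (j <= k)%N -> lex_greedy M k `<=` lex_greedy M j.
  move=> /subnK <-; elim: (k - j)%N => // i IH; rewrite addSn.
  exact: subset_trans IH.
pose u k := sval (cid (greedy0 k)).
have uP k : lex_greedy M k (u k) by rewrite /u; case: cid.
(* The sequence [u] is eventually in each of the decreasing closed greedy sets, so its cluster point
   [p] lies in all of them. *)
have [p [_ pu]] := cX (u @ \oo) _ filterT.
have pgreedy k : lex_greedy M k p.
  apply: greedy_closed => N Np.
  have [|x [kx Nx]] := pu (lex_greedy M k) N _ Np; last by exists x.
  by exists k => // i /= ki; apply: (greedy_le _ _ ki).
exists p; first exact: (pgreedy 0%N).
(* A larger [y] agrees with [p] below [k], so it survives the first [k] choices. It then witnesses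
   that choice [k] keeps only points of [U k], which excludes [p]. *)
move=> y My [k [agree nUp Uy]].
have ygreedy j : (j <= k)%N -> lex_greedy M j y.
  elim: j => [//|j IH] jk; have := pgreedy j.+1; rewrite /=.
  case: pselect => /= [_ [_ Ujp]|_ _]; last exact/IH/ltnW.
  by split; [exact/IH/ltnW|apply/agree].
have := pgreedy k.+1; rewrite /=; case: pselect => /= [_ []//|nk _].
by apply: nk; exists y; split=> //; exact: ygreedy.
Qed.

End lexicographic.

(** * Points that are maximal in their orbit *)

Section orbit_max.
Context {X : topologicalType}.
Variable f : homeomorphism X X.
Variable U : nat -> set X.
Hypothesis clopenU : forall k, clopen (U k).
Hypothesis sepU : forall x y, x <> y -> exists k, U k x /\ ~ U k y.

Definition orbit_max : set X := [set x | forall n, ~ lex_lt U x (iterz f n x)].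

Lemma closed_orbit_max : closed orbit_max.
Proof.
rewrite (_ : orbit_max = ~` \bigcup_n [set x | lex_lt U x (iterz f n x)]).
  apply: open_closedC; apply: bigcup_open => n _.
  apply: (open_lex_lt _ clopenU id) => x; first exact: cvg_id.
  exact: iterz_continuous.
apply/seteqP; split=> [x xmax [n _] /xmax//|x xmax n xn].
by apply: xmax; exists n.
Qed.

Lemma orbit_max_eq x y : zorbit f x y -> orbit_max x -> orbit_max y -> x = y.
Proof.
move=> [n _ <-] xmax /(_ (- n)%R); rewrite iterzNK => ymax.
by apply: contrapT => /(lex_lt_total _ sepU)[/xmax|/ymax].
Qed.

(** If [a] were below [b] in [M], the points above [a] would form a neighbourhood of [b], which the
    dense orbit of [a] meets, against the maximality of [a]. *)
Lemma minimal_set_orbit_max_eq M x y : minimal_set f M ->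
  M x -> M y -> orbit_max x -> orbit_max y -> x = y.
Proof.
move=> [_ _ _ Mmin].
have lt_absurd a b : M a -> M b -> orbit_max a -> ~ lex_lt U a b.
  move=> Ma Mb amax ab.
  have oab : open [set z | lex_lt U a z].
    apply: (open_lex_lt _ clopenU (fun=> a) id) => z; first exact: cvg_cst.
    exact: cvg_id.
  have [|z [[n _ <-] /amax//]] := Mmin a Ma b Mb [set z | lex_lt U a z].
  exact: open_nbhs_nbhs.
move=> Mx My xmax ymax.
by apply: contrapT => /(lex_lt_total _ sepU)[]; exact: lt_absurd.
Qed.

Lemma exists_minimal_set_orbit_max M : compact [set: X] -> minimal_set f M ->
  exists2 m, M m & orbit_max m.
Proof.
move=> cX mM; have [M0 cM _ _] := mM.
have [m Mm mmax] := exists_lex_max _ clopenU M cX cM M0.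
exists m => // n; apply: mmax; apply: (minimal_set_zorbit f M m) => //.
by exists n.
Qed.

End orbit_max.

(** * Recurrence and the basic set [B] *)

Lemma card_le_I1 {T : Type} (A : set T) :
  (forall x y, A x -> A y -> x = y) -> (A #<= `I_1)%card.
Proof.
move=> A1; have [->|/set0P[x Ax]] := eqVneq A set0; first exact: card_ge0.
rewrite -(card_le_eqr (@card_set1 _ x)).
by apply: subset_card_le => y Ay; exact: A1.
Qed.

(* Every orbit of a minimal set is forward recurrent, because the limit points
   of the forward orbit stay in the set and so have dense orbits there. *)
Lemma minimal_set_recurrent {X : topologicalType} (f : homeomorphism X X)
    (M V : set X) (m : X) : compact [set: X] -> minimal_set f M -> M m ->
  open V -> V m -> exists n : nat, V (iter n.+1 f m).
Proof.
move=> cX mM Mm oV Vm; have [_ cM _ Mmin] := mM.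
have Morb k : M (iter k f m).
  by apply: (minimal_set_zorbit f M m) => //; exists (Posz k).
have [z [_ zcl]] := cX ((fun k => iter k f m) @ \oo) _ filterT.
have Mz : M z.
  apply: cM => N Nz; have [|y [My Ny]] := zcl M N _ Nz; last by exists y.
  by exists 0%N => // k _; exact: Morb.
have [|_ [[n _ <-] Vnz]] := Mmin z Mz m Mm V; first exact: open_nbhs_nbhs.
(* The orbit of [z] visits [V] at a time [n] that may be negative; taking [k] above the absolute
   value of [n] makes the total time [n + k] positive. *)
have [||_ [[k nk <-] Vk]] := zcl
    [set y | exists2 k, (`|n| < k)%N & iter k f m = y] (iterz f n @^-1` V).
- by exists `|n|.+1 => // k /= nk; exists k.
- by apply: iterz_continuous; exact: open_nbhs_nbhs.
have : (0 < n + k%:Z)%R by lia.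
have : V (iterz f (n + k%:Z)%R m) by rewrite iterzD.
by case: (n + k%:Z)%R => // -[//|i] Vi _; exists i.
Qed.

Theorem theorem5p11 (R : realType) (X : topologicalType)
    (f : homeomorphism X X) (hX : zero_dim_space R X)
    (hf : densely_aperiodic f) :
  exists B : set X,
    [/\ minimal_basic_set f B,
        continuously_decisive f B &
        forall M : set X, minimal_set f M -> (M `&` B #= `I_1)%card].
Proof.
have [_ cX _ _] := hX.
have [U clopenU sepU] := countable_clopen_separation R X hX.
pose E := [set m | orbit_max f U m /\ exists2 M, minimal_set f M & M m].
pose B := closure E.
have Bmax : B `<=` orbit_max f U.
  have /closure_id -> := closed_orbit_max f U clopenU.
  by apply: closure_subset => m [].
have MB M : minimal_set f M -> exists2 m, M m & B m.
  move=> mM; have [m Mm mmax] := exists_minimal_set_orbit_max f U clopenU M cX mM.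
  by exists m => //; apply: subset_closure; split=> //; exists M.
have Borbit x y z : B y -> B z -> zorbit f x y -> zorbit f x z -> y = z.
  move=> By Bz [i _ iy] [j _ jz].
  apply: (orbit_max_eq f U sepU); [|exact: Bmax|exact: Bmax].
  by exists (j - i)%R => //; rewrite -iy iterzD iterzNK.
have basicB : basic_set f B.
  split=> [|x]; last first.
    by apply: card_le_I1 => y z [xy By] [xz Bz]; exact: Borbit xy xz.
  split=> [|V oV BV]; first exact: closed_closure.
  (* Otherwise the complement of the orbit of [V] contains a minimal set, whose point in [B] lies in
     [V]. *)
  apply: contrapT => VT.
  have [||| M mM MV] := exists_minimal_set f (~` zorbit_set f V) cX.
  - exact/open_closedC/open_zorbit_set.
  - exact/finvariantC/finvariant_zorbit_set.
  - apply: contrapT => /set0P/negP/negPn/eqP nV; apply: VT.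
    by rewrite -[LHS]setCK nV setC0.
  have [m Mm /BV Vm] := MB M mM.
  by apply: (MV m Mm); exists 0%R => //; exists m.
exists B; split.
- split=> // A [[cA qA] _] AB; apply/seteqP; split=> //.
  (* Since [A] is closed, it suffices that [A] contains [E]. *)
  have /closure_id -> := cA.
  apply: closure_subset => m [mmax [M mM Mm]].
  have [_ cM imM _] := mM.
  have [a [Ma Aa]] : M `&` A !=set0.
    (* If [A] missed [M], the complement of [M] would be an open invariant set around [A], so its
       orbit could not reach [m]. *)
    apply/set0P/negP => /eqP/disjoints_subset MA0.
    have fMC := finvariantC f _ (finvariant_image f M imM).
    have [n _ [y nMy nym]] : zorbit_set f (~` M) m.
      rewrite qA//; first exact: closed_openC.
      by move=> x Ax Mx; exact: (MA0 x).
    by move: Mm; rewrite -nym; exact/(finvariant_iterz f _ n y fMC).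
  rewrite (minimal_set_orbit_max_eq f U clopenU sepU M m a)//.
  exact/Bmax/AB.
- split=> //; apply/seteqP; split=> // x Bx.
  have [m [[mmax [M mM Mm]] Vm]] : E `&` interior B !=set0.
    apply: (interior_subset Bx); apply: open_nbhs_nbhs; split=> //.
    exact: open_interior.
  have [n Vn] := minimal_set_recurrent f M (interior B) m cX mM Mm (@open_interior _ B) Vm.
  have [y [[Vy /= Vny] yap]] : (interior B `&` iterz f (Posz n.+1) @^-1` interior B)
      `&` [set x | aperiodic f x] !=set0.
    apply: hf; first by exists m.
    apply: openI; first exact: open_interior.
    apply: open_comp => [z _|]; [exact: iterz_continuous|exact: open_interior].
  (* Both [y] and its iterate lie in [B], hence they coincide and the orbit of [y] is finite. *)
  apply: yap; apply: (periodic_zorbit_finite f n); apply/esym.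
  apply: (Borbit y); [exact: interior_subset|exact: interior_subset Vny| |].
  - exact: zorbit_refl.
  - by exists (Posz n.+1).
- move=> M mM; have [m Mm Bm] := MB M mM.
  rewrite (_ : M `&` B = [set m]); first exact: card_set1.
  apply/seteqP; split=> [x [Mx Bx]|_ ->//].
  by apply: (minimal_set_orbit_max_eq f U clopenU sepU M) => //; exact: Bmax.
Qed.
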